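(* In the quantum switch model of the context (with $W=\infty$), assume in addition that the request processes $\{A_{ij}(t):t\ge0\}$, $i,j\in\mathcal K$, are mutually independent Bernoulli processes. If $(\lambda_{ij}+\epsilon)_{i,j\in\mathcal K}\in\Lambda$ for some $\epsilon>0$, then under the stationary protocol $\pi_{\mathrm{STAT}}$ all requests are served in one time slot on average, i.e. the long-run average latency of requests (number of slots from the slot of a request's arrival until it is addressed) is one slot, the minimum possible since a request arriving in slot $t$ can be addressed no earlier than slot $t+1$.
   Context: Quantum switch model. There are $K$ end nodes $\mathcal K=\{1,\dots,K\}$ and a switch (node $0$); time is slotted, $t=0,1,2,\dots$; pair-indexed quantities are symmetric in $(i,j)$. In slot $t$: (i) $C_{0i}(t)\in\{0,1\}$ EPR pairs are generated between the switch and node $i$, where $\{C_{0i}(t)\}_{t\ge0}$ are mutually independent Bernoulli processes (i.i.d. in $t$) with mean $p_i$. (ii) The switch chooses nonnegative integers $F_{ij}(t)=F_{ji}(t)$ (entanglement swaps for pair $(i,j)$, each consuming one stored switch–$i$ and one stored switch–$j$ pair) with $\sum_iF_{ij}(t)\le E_{0j}(t)$; no limit on swaps per slot ($W=\infty$); each swap succeeds independently with probability $q$; $R_{ij}(t)$ is the number of successes. (iii) $A_{ij}(t)$ new requests for pair $(i,j)$ arrive, with rate $\lambda_{ij}=\mathbb E[A_{ij}(t)]$. Dynamics: $U_{ij}(t+1)=[U_{ij}(t)-E_{ij}(t)-R_{ij}(t)]^++A_{ij}(t)$, $E_{ij}(t+1)=[E_{ij}(t)+R_{ij}(t)-U_{ij}(t)]^+$,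 $E_{0i}(t+1)=E_{0i}(t)-\sum_jF_{ij}(t)+C_{0i}(t)$, with zero initial values; $U_{ij}$ = pending requests, $E_{ij}$ = stored $i$–$j$ pairs, $E_{0i}$ = stored switch–$i$ pairs; memory unlimited, no decoherence. $\Lambda$ is the set of nonnegative matrices $(\lambda_{ij})$ for which there exist nonnegative $f_{ij}=f_{ji}$ with $\sum_if_{ij}\le p_j$ for all $j$ and $\lambda_{ij}\le qf_{ij}$ for all $i,j$. Stationary protocol $\pi_{\mathrm{STAT}}$: with $\epsilon$ as in the claim, fix $\tilde f_{ij}=\tilde f_{ji}\ge0$ with $\sum_i\tilde f_{ij}\le p_j$ and $\lambda_{ij}+\epsilon\le q\tilde f_{ij}$ (e.g. $\tilde f_{ij}=(\lambda_{ij}+\epsilon)/q$). Each switch–$i$ pair generated in any slot is, independently, labelled $(i,j)$ with probability $\tilde f_{ij}/p_i$. Let $\mathcal M^i_{ij}(t)$ be the set of switch–$i$ pairs labelled $(i,j)$ not consumed up to slot $t$; whenever $\mathcal M^i_{ij}(t)$ and $\mathcal M^j_{ij}(t)$ are both nonempty, the switch performs swaps for pair $(i,j)$ consuming one pair from each until one of them is empty. *)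

(* Defs.v *)
From HB Require Import structures.
From mathcomp Require Import all_boot all_order all_algebra.
From mathcomp Require Import all_classical all_reals all_analysis.
Set Implicit Arguments. Unset Strict Implicit. Unset Printing Implicit Defensive.
Import Order.TTheory GRing.Theory Num.Theory numFieldNormedType.Exports.
Local Open Scope classical_set_scope.
Local Open Scope ring_scope.

(* Capacity region Lambda (pairs are unordered pairs of DISTINCT end   *)
(* nodes).                                               *)
Definition inLambda (R : realType) (K : nat) (p : 'I_K -> R) (q : R)
  (lam : 'I_K -> 'I_K -> R) : Prop :=
  (forall i j, i != j -> 0 <= lam i j) /\
  exists f : 'I_K -> 'I_K -> R,
    (forall i j, 0 <= f i j) /\ (forall i j, f i j = f j i) /\
    (forall j, \sum_(i < K | i != j) f i j <= p j) /\
    (forall i j, i != j -> lam i j <= q * f i j).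

(* Deterministic sample-path dynamics under pi_STAT, given the random  *)
(* inputs of one outcome:                                              *)
(*  c i t      : C_{0i}(t) (a switch-i pair is generated in slot t)    *)
(*  l i t      : label of the switch-i pair generated in slot t:       *)
(*               Some j (j != i) = labelled (i,j); otherwise unlabelled *)
(*  s i j t k  : success of the k-th swap for pair (i,j) in slot t     *)
(*               (used for i < j)                                      *)
(*  a i j t    : A_{ij}(t) (used for i < j)                            *)
Section Dynamics.
Local Open Scope nat_scope.
Variables (K : nat) (c : 'I_K -> nat -> bool) (l : 'I_K -> nat -> option 'I_K)
  (s : 'I_K -> 'I_K -> nat -> nat -> bool) (a : 'I_K -> 'I_K -> nat -> bool).

Definition symp (X : Type) (f : 'I_K -> 'I_K -> X) (i j : 'I_K) : X :=
  if (i < j)%N then f i j else f j i.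

Definition swaps_of (m : 'I_K -> 'I_K -> nat) (i j : 'I_K) : nat :=
  if i != j then minn (m i j) (m j i) else 0.

(* pool t i j = |M^i_{ij}(t)| : switch-i pairs labelled (i,j) generated
   before slot t and not consumed before slot t *)
Fixpoint pool (t : nat) : 'I_K -> 'I_K -> nat :=
  match t with
  | 0 => fun _ _ => 0
  | t'.+1 => fun i j =>
      (pool t' i j - swaps_of (pool t') i j) + (c i t' && (l i t' == Some j))
  end.

Definition F (i j : 'I_K) (t : nat) : nat := swaps_of (pool t) i j.

Definition Rsucc (i j : 'I_K) (t : nat) : nat :=
  \sum_(k < F i j t) (symp (fun i' j' => s i' j' t k) i j : nat).

Fixpoint UE (i j : 'I_K) (t : nat) : nat * nat :=
  match t with
  | 0 => (0, 0)
  | t'.+1 => let: (u, e) := UE i j t' in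
             ((u - (e + Rsucc i j t')) + symp (fun i' j' => a i' j' t') i j,
              (e + Rsucc i j t') - u)
  end.

Definition U i j t := (UE i j t).1.
Definition E i j t := (UE i j t).2.

Definition served (i j : 'I_K) (t : nat) : nat := minn (U i j t) (E i j t + Rsucc i j t).

Definition cum_served (i j : 'I_K) (t : nat) : nat := \sum_(u < t.+1) served i j u.

(* index (0-based, in arrival order) of the request of pair (i,j)
   arriving in slot t *)
Definition req_index (i j : 'I_K) (t : nat) : nat := \sum_(u < t) a i j u.

(* requests of a pair are addressed in FIFO order: the request with index
   n is addressed in slot s iff s is the first slot by which more than n
   requests of the pair have been addressed *)
Definition addressed_at (i j : 'I_K) (t sl : nat) : Prop :=
  (req_index i j t < cum_served i j sl)%N /\
  forall sl', (sl' < sl)%N -> (cum_served i j sl' <= req_index i j t)%N.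

(* latency (in slots) of the request of pair (i,j) arriving in slot t;
   meaningful when the request is addressed at some slot *)
Definition latency (i j : 'I_K) (t : nat) : nat :=
  xget 0%N [set sl | addressed_at i j t sl] - t.

Definition num_requests (T : nat) : nat :=
  \sum_(i < K) \sum_(j < K | (i < j)%N) \sum_(t < T) (a i j t : nat).

Definition total_latency (T : nat) : nat :=
  \sum_(i < K) \sum_(j < K | (i < j)%N) \sum_(t < T | a i j t) latency i j t.

End Dynamics.

(* Index set of all the primitive random variables, and their encoding *)
(* as nat-valued observations (for stating mutual independence).       *)
Definition src (K : nat) : Type :=
  (('I_K * nat) + ('I_K * nat)) + (('I_K * 'I_K * nat * nat) + ('I_K * 'I_K * nat)).

Definition src_valid (K : nat) (x : src K) : bool :=
  match x with
  | inl _ => true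
  | inr (inl (i, j, _, _)) => (i < j)%N
  | inr (inr (i, j, _)) => (i < j)%N
  end.

Definition obs (T : Type) (K : nat) (C : 'I_K -> nat -> T -> bool)
  (L : 'I_K -> nat -> T -> option 'I_K)
  (S : 'I_K -> 'I_K -> nat -> nat -> T -> bool)
  (A : 'I_K -> 'I_K -> nat -> T -> bool) (x : src K) (w : T) : nat :=
  match x with
  | inl (inl (i, t)) => C i t w
  | inl (inr (i, t)) => if L i t w is Some j then (nat_of_ord j).+1 else 0
  | inr (inl (i, j, t, k)) => S i j t k w
  | inr (inr (i, j, t)) => A i j t w
  end.

Definition mutually_independent (d : measure_display) (T : measurableType d)
  (R : realType) (P : probability T R) (I : eqType) (J : pred I)
  (X : I -> T -> nat) : Prop :=
  forall (s : seq I) (v : I -> nat), uniq s -> all J s ->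
    P [set w | forall x, x \in s -> X x w = v x] =
    (\prod_(x <- s) P [set w | X x w = v x])%E.

(* Main.v *)
Require Import Defs.
From HB Require Import structures.
From mathcomp Require Import all_boot all_order all_algebra.
From mathcomp Require Import all_classical all_reals all_analysis.
From mathcomp Require Import zify ring lra.
Set Implicit Arguments. Unset Strict Implicit. Unset Printing Implicit Defensive.
Import Order.TTheory GRing.Theory Num.Theory numFieldNormedType.Exports.
Local Open Scope classical_set_scope.
Local Open Scope ring_scope.

(** Fix a pair (i, j) with i < j. Through slot t the protocol has performed exactly
    min(N1, N2) swaps for it, where N1 and N2 count the pairs labelled (i, j) that
    were generated before slot t at i and at j; so at most one swap takes place per
    slot. Hence the probability that the requests arrived before slot t outnumber the
    swaps succeeded through slot t is at most E[z^min(N1, N2)] (1 + lam (y - 1))^t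
    with z = 1 - q + q/y, for any y > 1. Since z^min(N1, N2) <= z^N1 + z^N2, this is
    at most 2 ((1 - f q (1 - 1/y)) (1 + lam (y - 1)))^t, which is summable for
    y = 1 + eps/2 because lam + eps <= q f. By Borel-Cantelli, almost surely every
    queue is cleared in each slot from some slot on, so all but finitely many requests
    have latency exactly one. *)

(** * Swap counts as a function of the labelled pairs *)

Section Swaps.
Local Open Scope nat_scope.
Implicit Types (b : nat -> bool) (t : nat).

(* A pair generated in slot [u] is usable from slot [u.+1] on, so the pairs generated
   in slots [0 .. t - 1] account for the swaps of slots [0 .. t]. *)
Definition swap_count b1 b2 t : nat :=
  minn (\sum_(u < t) b1 u) (\sum_(u < t) b2 u).

(** As [0.-1] is 0, there is no swap in slot 0, whose pools are empty. *)
Definition swap b1 b2 t : bool := swap_count b1 b2 t.-1 < swap_count b1 b2 t.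

Lemma swap_countS b1 b2 t :
  swap_count b1 b2 t.+1 = swap_count b1 b2 t + swap b1 b2 t.+1.
Proof. by rewrite /swap /swap_count !big_ord_recr /=; case: (b1 t); case: (b2 t); lia. Qed.

Lemma sum_swap b1 b2 t :
  \sum_(u < t.+1) swap b1 b2 u = swap_count b1 b2 t.
Proof.
elim: t => [|t IH]; last by rewrite big_ord_recr /= IH swap_countS.
by rewrite big_ord1 /swap /swap_count !big_ord0.
Qed.

End Swaps.

(** * Sample-path dynamics of one pair *)

Section Pair.
Local Open Scope nat_scope.
Variables (K : nat) (c : 'I_K -> nat -> bool) (l : 'I_K -> nat -> option 'I_K)
  (s : 'I_K -> 'I_K -> nat -> nat -> bool) (a : 'I_K -> 'I_K -> nat -> bool).
Variables (i j : 'I_K).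
Hypothesis ij : i < j.

Let b1 t := c i t && (l i t == Some j).
Let b2 t := c j t && (l j t == Some i).

(** A labelled pair is either still pooled or consumed earlier, and the swaps of each slot empty the
    smaller pool. So the swaps through a slot number the smaller of the two generation counts. *)
Lemma pool_swap_count t :
  pool c l t i j + swap_count b1 b2 t.-1 = \sum_(u < t) b1 u /\
  pool c l t j i + swap_count b1 b2 t.-1 = \sum_(u < t) b2 u.
Proof.
have nij : (i == j) = false by apply/negbTE/eqP => e; move: ij; rewrite e ltnn.
elim: t => [|t [IH1 IH2]]; first by rewrite /swap_count !big_ord0.
rewrite !big_ord_recr /= -/(b1 t) -/(b2 t) /swaps_of nij eq_sym nij /=.
rewrite -IH1 -IH2.
suff : swap_count b1 b2 t.-1 + minn (pool c l t i j) (pool c l t j i)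
       = swap_count b1 b2 t by lia.
by rewrite /(swap_count _ _ t) -IH1 -IH2; lia.
Qed.

Lemma F_swap t : F c l i j t = swap b1 b2 t.
Proof.
have nij : (i == j) = false by apply/negbTE/eqP => e; move: ij; rewrite e ltnn.
have [H1 H2] := pool_swap_count t.
have : F c l i j t + swap_count b1 b2 t.-1 = swap_count b1 b2 t.
  by rewrite /F /swaps_of nij /= /(swap_count _ _ t) -H1 -H2; lia.
by case: t {H1 H2} => [|t]; rewrite ?swap_countS /swap /=; lia.
Qed.

Lemma Rsucc_swap t : Rsucc c l s i j t = swap b1 b2 t && s i j t 0.
Proof.
rewrite /Rsucc F_swap; case: swap; last by rewrite big_ord0.
by rewrite big_ord1 /symp ij.
Qed.

(** The two truncated differences in the dynamics differ by exactly [u - (e + r)], so requests minus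
    stored pairs follow arrivals minus successes without loss. *)
Lemma UE_balance t :
  U c l s a i j t + \sum_(u < t) Rsucc c l s i j u
  = E c l s a i j t + \sum_(u < t) a i j u.
Proof.
elim: t => [|t IH]; first by rewrite !big_ord0.
rewrite !big_ord_recr /=; move: IH; rewrite /U /E /=.
by case: (UE _ _ _ _ _ _ _) => u e /=; rewrite /symp ij; lia.
Qed.

Lemma cum_served_balance t :
  cum_served c l s a i j t + U c l s a i j t.+1 = \sum_(u < t.+1) a i j u.
Proof.
have step v : served c l s a i j v + U c l s a i j v.+1
    = U c l s a i j v + a i j v.
  rewrite /served /U /E /=; case: (UE _ _ _ _ _ _ _) => u e /=.
  by rewrite /symp ij; lia.
elim: t => [|t IH]; first by rewrite /cum_served !big_ord1 step.
rewrite /cum_served big_ord_recr /= -/(cum_served c l s a i j t).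
by rewrite [RHS]big_ord_recr /= -IH -addnA step addnA.
Qed.

Lemma arrival_le_U t : a i j t <= U c l s a i j t.+1.
Proof. by rewrite /U /=; case: (UE _ _ _ _ _ _ _) => u e /=; rewrite /symp ij; lia. Qed.

(** A request arriving in slot t is still pending in slot [t.+1], so no latency is below one. *)
Lemma cum_served_le t : cum_served c l s a i j t <= req_index a i j t.
Proof.
have := cum_served_balance t; have := arrival_le_U t.
by rewrite /req_index big_ord_recr /=; lia.
Qed.

(** Stated through the random inputs alone, so that its probability can be bounded without the queue
    recursion. *)
Definition backlog_cleared t :=
  \sum_(u < t) a i j u <= \sum_(u < t.+1) (swap b1 b2 u && s i j u 0).

(** By [UE_balance], the hypothesis bounds the pending requests by the stored pairs plus the
    successes of slot t. All of them are served, and only the arrivals of slot t remain. *)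
Lemma backlog_cleared_cum_served t : backlog_cleared t ->
  cum_served c l s a i j t = req_index a i j t.
Proof.
rewrite /backlog_cleared => good.
have {}good : \sum_(u < t) a i j u <= \sum_(u < t.+1) Rsucc c l s i j u.
  by under [X in _ <= X]eq_bigr do rewrite Rsucc_swap.
have := cum_served_balance t; have := UE_balance t; move: good.
rewrite /req_index !big_ord_recr /= /U /E /=.
by case: (UE _ _ _ _ _ _ _) => u e /=; rewrite /symp ij; lia.
Qed.

Lemma req_index_leq t t' : t <= t' -> req_index a i j t <= req_index a i j t'.
Proof.
move=> /subnKC <-; elim: (t' - t) => [|n IH]; first by rewrite addn0.
by rewrite addnS {2}/req_index big_ord_recr /=; apply: leq_trans IH (leq_addr _ _).
Qed.

Lemma req_indexS t : a i j t -> req_index a i j t.+1 = (req_index a i j t).+1.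
Proof. by move=> h; rewrite /req_index big_ord_recr /= h addn1. Qed.

Variable N : nat.
Hypothesis goodN : forall t, N <= t -> backlog_cleared t.

Lemma addressed_eventually t : a i j t -> exists sl, addressed_at c l s a i j t sl.
Proof.
move=> at_.
have ex : exists sl, req_index a i j t < cum_served c l s a i j sl.
  exists (maxn N t.+1).
  rewrite backlog_cleared_cum_served ?goodN ?leq_maxl // -req_indexS //.
  exact/req_index_leq/leq_maxr.
exists (ex_minn ex); case: ex_minnP => m h1 h2; split=> // m' m'm.
by rewrite leqNgt; apply/negP => /h2; rewrite leqNgt m'm.
Qed.

(** In slot [t.+1] all arrivals through slot t have been served, while [cum_served_le] excludes
    every slot up to t. *)
Lemma latency1 t : N <= t -> a i j t -> latency c l s a i j t = 1.
Proof.
move=> Nt at_; rewrite /latency.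
have addr : addressed_at c l s a i j t t.+1.
  split=> [|m].
    by rewrite backlog_cleared_cum_served ?req_indexS ?goodN // (leq_trans Nt).
  by rewrite ltnS => mt; apply: leq_trans (cum_served_le m) (req_index_leq _).
(* The set is the singleton of [t.+1], so [xget] does not return its default 0. *)
rewrite (@xget_unique _ 0 [set sl | addressed_at c l s a i j t sl] t.+1) ?subSnn //.
move=> m [h1 h2]; apply/eqP; rewrite eqn_leq; apply/andP; split.
  by rewrite leqNgt; apply/negP => /h2; rewrite leqNgt addr.1.
by rewrite leqNgt; apply/negP => /addr.2; rewrite leqNgt h1.
Qed.

End Pair.

(** * Long-run average over all pairs *)

Section Total.
Variables (K : nat) (c : 'I_K -> nat -> bool) (l : 'I_K -> nat -> option 'I_K)
  (s : 'I_K -> 'I_K -> nat -> nat -> bool) (a : 'I_K -> 'I_K -> nat -> bool).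
Variable N : nat.
Hypothesis goodN : forall i j : 'I_K, (i < j)%N -> forall t, (N <= t)%N ->
  backlog_cleared c l s a i j t.

(** From slot N on, each request adds one both to the total latency and to the number of requests,
    so their difference stays constant. *)
Lemma total_latency_eventually n :
  (total_latency c l s a (N + n) + num_requests a N
   = total_latency c l s a N + num_requests a (N + n))%N.
Proof.
elim: n => [|n IH]; first by rewrite addn0.
have latS : total_latency c l s a (N + n).+1 = (total_latency c l s a (N + n)
    + \sum_(i < K) \sum_(j < K | (i < j)%N) a i j (N + n))%N.
  rewrite /total_latency -big_split /=; apply: eq_bigr => i _.
  rewrite -big_split /=; apply: eq_bigr => j ij.
  rewrite big_mkcond big_ord_recr -big_mkcond /=; congr addn.
  by case: ifP => // h; rewrite (latency1 ij (goodN ij)) // leq_addr.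
have reqS : num_requests a (N + n).+1 = (num_requests a (N + n)
    + \sum_(i < K) \sum_(j < K | (i < j)%N) a i j (N + n))%N.
  rewrite /num_requests -big_split /=; apply: eq_bigr => i _.
  by rewrite -big_split /=; apply: eq_bigr => j _; rewrite big_ord_recr.
by rewrite addnS latS reqS; lia.
Qed.

Lemma num_requests_leq t t' : (t <= t')%N -> (num_requests a t <= num_requests a t')%N.
Proof.
move=> tt'; apply: leq_sum => i _; apply: leq_sum => j _.
exact: (@req_index_leq K a i j).
Qed.

Lemma average_latency_cvg1 (R : realType) :
  (forall M, exists Tn, (M <= num_requests a Tn)%N) ->
  (fun Tn => (total_latency c l s a Tn)%:R / (num_requests a Tn)%:R : R)
    @ \oo --> (1 : R).
Proof.
move=> unb.
have reqoo : (num_requests a n)%:R @[n --> \oo] --> (+oo : set_system R).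
  apply/cvgryPge => M; have [n hn] := unb (Num.truncn `|M|).+1.
  near=> m; apply: (@le_trans _ _ (num_requests a n)%:R); last first.
    by rewrite ler_nat num_requests_leq//; near: m; exact: nbhs_infty_ge.
  apply: le_trans (ler_norm M) _; apply: le_trans (ltW (truncnS_gt _)) _.
  by rewrite ler_nat.
(* The constant difference: the average is 1 plus k over the diverging number of requests. *)
pose k : R := (total_latency c l s a N)%:R - (num_requests a N)%:R.
have lim1 : 1 + k * (num_requests a n)%:R^-1 @[n --> \oo] --> (1 : R).
  rewrite -[X in _ --> X]addr0 -[X in 1 + X](mulr0 k).
  apply: cvgD; first exact: cvg_cst.
  apply: cvgMl_tmp; apply/gtr0_cvgV0 => //.
  by near=> n; near: n; move/cvgryPgt: reqoo; apply.
apply: cvg_trans lim1; apply: near_eq_cvg.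
near=> n.
have pos : (num_requests a n)%:R != 0 :> R.
  by rewrite gt_eqF//; near: n; move/cvgryPgt: reqoo; apply.
have Nn : (N <= n)%N by near: n; exact: nbhs_infty_ge.
have := total_latency_eventually (n - N); rewrite subnKC// => eqn.
have eqR : (total_latency c l s a n)%:R = k + (num_requests a n)%:R :> R.
  have /(congr1 (fun m => m%:R : R)) := eqn; rewrite !natrD /k => e; lra.
by rewrite eqR [RHS]mulrDl divff// addrC.
Unshelve. all: by end_near. Qed.

End Total.

(** * Independent Bernoulli coordinates *)

Section BernoulliExpectation.
Variables (R : realType) (I : eqType) (p : I -> R).
Implicit Types (v : I -> bool) (g : (I -> bool) -> R) (s : seq I).

(* Expectation of [g] over independent Bernoulli coordinates in [s], the remaining
   coordinates being read off [v]. *)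
Fixpoint Ex s g v : R :=
  if s is x :: s' then
    p x * Ex s' g [eta v with x |-> true] + (1 - p x) * Ex s' g [eta v with x |-> false]
  else g v.

Lemma Ex_cat s1 s2 g v : Ex (s1 ++ s2) g v = Ex s1 (Ex s2 g) v.
Proof. by elim: s1 v => //= x s1 IH v; rewrite !IH. Qed.

Lemma ExD s g1 g2 v : Ex s (fun v => g1 v + g2 v) v = Ex s g1 v + Ex s g2 v.
Proof. by elim: s v => //= x s IH v; rewrite !IH; ring. Qed.

Lemma ExZ s k g v : Ex s (fun v => k * g v) v = k * Ex s g v.
Proof. by elim: s v => //= x s IH v; rewrite !IH; ring. Qed.

Lemma le_Ex s g1 g2 v : (forall x, 0 <= p x <= 1) -> (forall v, g1 v <= g2 v) ->
  Ex s g1 v <= Ex s g2 v.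
Proof.
move=> p01 g12; elim: s v => //= x s IH v.
by have /andP[p0 p1] := p01 x; rewrite lerD// ler_wpM2l// subr_ge0.
Qed.

(** Product rule for independent coordinates. The factors [h v] may depend on v, but only through
    coordinates outside s, which stay fixed during the integration. *)
Lemma Ex_prod s (h : (I -> bool) -> I -> bool -> R) v : uniq s ->
  (forall v x b, x \in s -> h [eta v with x |-> b] = h v) ->
  Ex s (fun v => \prod_(x <- s) h v x (v x)) v =
  \prod_(x <- s) (p x * h v x true + (1 - p x) * h v x false).
Proof.
move=> us hinv.
(* The prefactor k absorbs the head factor in the induction. *)
suff gen (k : (I -> bool) -> R) v0 : (forall v x b, x \in s -> k [eta v with x |-> b] = k v) ->
    Ex s (fun v => k v * \prod_(x <- s) h v x (v x)) v0 =
    k v0 * \prod_(x <- s) (p x * h v0 x true + (1 - p x) * h v0 x false).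
  rewrite -[RHS]mul1r -(gen (fun=> 1))//.
  by congr Ex; apply/funext => w; rewrite mul1r.
elim: s us hinv k v0 => [|x s IH] /=; first by move=> *; rewrite !big_nil.
move=> /andP[xs us] hinv k v0 kinv.
have step b : Ex s (fun v => k v * \prod_(y <- x :: s) h v y (v y))
      [eta v0 with x |-> b] =
    k v0 * h v0 x b * \prod_(y <- s) (p y * h v0 y true + (1 - p y) * h v0 y false).
  transitivity (Ex s (fun v => (k v * h v x (v x)) * \prod_(y <- s) h v y (v y))
      [eta v0 with x |-> b]).
    by congr Ex; apply/funext => w; rewrite big_cons mulrA.
  rewrite IH//; last 2 first.
  - by move=> w y c ys; rewrite hinv// inE ys orbT.
  - move=> w y c ys; rewrite hinv ?kinv ?inE ?ys ?orbT//=.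
    by case: eqP => // xy; rewrite xy ys in xs.
  by rewrite /= eqxx hinv ?kinv ?mem_head.
by rewrite !step big_cons; ring.
Qed.

Variables (d : measure_display) (T : measurableType d) (P : probability T R).
Variable (X : I -> T -> bool).
Hypothesis mX : forall x, measurable [set w | X x w].
Hypothesis indep : forall s, uniq s ->
  P [set w | forall x, x \in s -> X x w] = (\prod_(x <- s) p x)%:E.

Let mXs s : measurable [set w | forall x, x \in s -> X x w].
Proof.
elim: s => [|x s IH]; first by rewrite (_ : [set _ | _] = setT) ?measurableT//; apply/seteqP; split.
rewrite (_ : [set _ | _] = [set w | X x w] `&` [set w | forall y, y \in s -> X y w]).
  exact: measurableI.
apply/seteqP; split=> w /=.
  by move=> h; split=> [|y ys]; apply: h; rewrite inE ?eqxx// ys orbT.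
by move=> [h1 h2] y; rewrite inE => /predU1P[->//|/h2].
Qed.

Let assign s v w : I -> bool := fun y => if y \in s then X y w else v y.

Let assign_cons x s v w : assign (x :: s) v w = assign s [eta v with x |-> X x w] w.
Proof.
apply/funext => y; rewrite /assign /= inE.
by have [->|//] := eqVneq y x; case: ifP.
Qed.

Let event_nil (g : (I -> bool) -> bool) v :
  [set w | g (assign [::] v w)] = if g v then setT else set0.
Proof.
have aE w : assign [::] v w = v by apply/funext.
by apply/seteqP; split=> w /=; rewrite aE; case: (g v).
Qed.

Let event_cons (g : (I -> bool) -> bool) x s v :
  [set w | g (assign (x :: s) v w)] =
  ([set w | X x w] `&` [set w | g (assign s [eta v with x |-> true] w)]) `|`
  ([set w | g (assign s [eta v with x |-> false] w)] `\` [set w | X x w]).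
Proof.
apply/seteqP; split=> w /=; rewrite assign_cons.
  by case: (X x w) => gw; [left|right].
by case: (X x w) => -[] [].
Qed.

Let measurable_assign (g : (I -> bool) -> bool) s v :
  measurable [set w | g (assign s v w)].
Proof.
elim: s v => [|x s IH] v.
  by rewrite event_nil; case: ifP.
by rewrite event_cons; apply: measurableU; [exact: measurableI|exact: measurableD].
Qed.

(* The false branch is reached by inclusion-exclusion, so that only joint
   probabilities of the events [X x] themselves are needed. *)
Let prob_assign (g : (I -> bool) -> bool) r s v : uniq (r ++ s) ->
  P ([set w | forall x, x \in r -> X x w] `&` [set w | g (assign s v w)]) =
  (\prod_(x <- r) p x * Ex s (fun v => (g v)%:R) v)%:E.
Proof.
elim: s r v => [|x s IH] r v urs.
  rewrite event_nil cats0 /= in urs *; case: (g v).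
    by rewrite setIT indep// mulr1.
  by rewrite setI0 measure0 mulr0.
have uxrs : uniq ((x :: r) ++ s) by rewrite -(uniq_catCA [:: x]) in urs *.
have urs' : uniq (r ++ s) by move: uxrs => /= /andP[].
have consE : [set w | forall y, y \in r -> X y w] `&` [set w | X x w] =
    [set w | forall y, y \in x :: r -> X y w].
  apply/seteqP; split=> w /=.
    by move=> [h1 h2] y; rewrite inE => /predU1P[->//|/h1].
  by move=> h; split=> [y ys|]; apply: h; rewrite inE ?eqxx// ys orbT.
set A := [set w | forall y, y \in r -> X y w].
pose G b := [set w | g (assign s [eta v with x |-> b] w)].
have mA : measurable A by exact: mXs.
have mG b : measurable (G b) by exact: measurable_assign.
rewrite event_cons -/(G true) -/(G false) setIUr measureU/=; last 3 first.
- by apply: measurableI => //; exact: measurableI.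
- by apply: measurableI => //; exact: measurableD.
- by apply/seteqP; split=> w //= -[[_ [Xw _]] [_ [_]]].
have IHr b := IH r [eta v with x |-> b] urs'.
have IHxr b := IH (x :: r) [eta v with x |-> b] uxrs.
have finP : (P (A `&` G false) < +oo)%E.
  by rewrite (le_lt_trans (probability_le1 _ _)) ?ltry//; exact: measurableI.
have -> : P (A `&` (G false `\` [set w | X x w])) =
    (P (A `&` G false) - P ([set w | forall y, y \in x :: r -> X y w] `&` G false))%E.
  rewrite setIDA measureD//; last exact: measurableI.
  by congr (_ - _)%E; rewrite -consE setIAC.
rewrite setIA consE !IHxr IHr big_cons -EFinB -EFinD.
by congr EFin; ring.
Qed.

Lemma prob_Ex (g : (I -> bool) -> bool) s v : uniq s ->
  (forall v1 v2, {in s, v1 =1 v2} -> g v1 = g v2) ->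
  measurable [set w | g (X^~ w)] /\
  P [set w | g (X^~ w)] = (Ex s (fun v => (g v)%:R) v)%:E.
Proof.
move=> us gs.
have -> : [set w | g (X^~ w)] = [set w | g (assign s v w)].
  by apply/seteqP; split=> w /=; rewrite (gs _ (assign s v w))// => y ys; rewrite /assign ys.
split; first exact: measurable_assign.
have := @prob_assign g [::] s v us; rewrite big_nil mul1r => <-; congr (P _).
by apply/seteqP; split=> w /= => [gw|[]].
Qed.

Lemma bernoulli_mean_itv x : 0 <= p x <= 1.
Proof.
have e : P [set w | forall y, y \in [:: x] -> X y w] = (p x)%:E.
  by rewrite indep// big_seq1.
have mx : measurable [set w | forall y, y \in [:: x] -> X y w] by exact: mXs.
by rewrite -!lee_fin -e measure_ge0 probability_le1.
Qed.

End BernoulliExpectation.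

(** * Exponential bound on the backlog probability *)

Lemma prod_if_expr (R : comPzRingType) (z : R) (b : nat -> bool) n :
  \prod_(u <- iota 0 n) (if b u then z else 1) = z ^+ (\sum_(u < n) b u)%N.
Proof.
elim: n => [|n IH]; first by rewrite big_nil big_ord0.
rewrite -addn1 iotaD big_cat /= IH big_seq1 add0n addn1 big_ord_recr /= exprD.
by case: (b n).
Qed.

(* Coordinates of one pair (i, j) in slot [u]: [(false, false, u)] and
   [(false, true, u)] are the arrivals of pairs labelled (i, j) at nodes i and j,
   [(true, false, u)] is the success of the swap, [(true, true, u)] the request. *)
Local Notation coord := (bool * bool * nat)%type.

Section Chernoff.
Variables (R : realType) (f q la y : R).

Definition coord_mean (x : coord) : R :=
  match x with (false, _, _) => f | (true, false, _) => q | (true, true, _) => la end.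

Definition swap_of (v : coord -> bool) (u : nat) : bool :=
  swap (fun u => v (false, false, u)) (fun u => v (false, true, u)) u.

Definition backlogged (t : nat) (v : coord -> bool) : bool :=
  (\sum_(u < t.+1) (swap_of v u && v (true, false, u : nat))
   < \sum_(u < t) v (true, true, u : nat))%N.

(** Labels are kept apart from successes and requests, so that [Ex_cat] can average over the latter
    with the swap pattern held fixed. *)
Definition label_coords t : seq coord :=
  [seq (false, false, u) | u <- iota 0 t] ++ [seq (false, true, u) | u <- iota 0 t].
Definition other_coords t : seq coord :=
  [seq (true, false, u) | u <- iota 0 t.+1] ++ [seq (true, true, u) | u <- iota 0 t].

Lemma label_coordsP t x : x \in label_coords t -> x.1.1 = false.
Proof. by rewrite mem_cat => /orP[] /mapP[u _ ->]. Qed.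

Lemma other_coordsP t x : x \in other_coords t -> x.1.1 = true.
Proof. by rewrite mem_cat => /orP[] /mapP[u _ ->]. Qed.

Lemma uniq_label_coords t : uniq (label_coords t).
Proof.
rewrite cat_uniq !map_inj_uniq ?iota_uniq//=; try by move=> u1 u2 [].
by rewrite andbT; apply/hasPn => x /mapP[u _ ->]; apply/negP => /mapP[].
Qed.

Lemma uniq_other_coords t : uniq (other_coords t).
Proof.
rewrite cat_uniq !map_inj_uniq ?iota_uniq//; try by move=> u1 u2 [].
by rewrite andbT; apply/hasPn => x /mapP[u _ ->]; apply/negP => /mapP[].
Qed.

Lemma uniq_coords t : uniq (label_coords t ++ other_coords t).
Proof.
rewrite cat_uniq uniq_label_coords uniq_other_coords andbT andTb.
by apply/hasPn => x /other_coordsP x1; apply/negP => /label_coordsP; rewrite x1.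
Qed.

Lemma backlogged_local t (v1 v2 : coord -> bool) :
  {in label_coords t ++ other_coords t, v1 =1 v2} -> backlogged t v1 = backlogged t v2.
Proof.
move=> v12.
have vB k u : (u < t)%N -> v1 (false, k, u) = v2 (false, k, u).
  move=> ut; apply: v12; rewrite !mem_cat; apply/orP; left; apply/orP.
  by case: k; [right|left]; apply/mapP; exists u => //; rewrite mem_iota.
have cE n : (n <= t)%N ->
    swap_count (fun u => v1 (false, false, u)) (fun u => v1 (false, true, u)) n =
    swap_count (fun u => v2 (false, false, u)) (fun u => v2 (false, true, u)) n.
  move=> nt; congr minn; apply: eq_bigr => u _; rewrite vB//;
    exact: leq_trans (ltn_ord u) nt.
congr (_ < _)%N; apply: eq_bigr => u _.
  have ut : (u <= t)%N by rewrite -ltnS ltn_ord.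
  congr (nat_of_bool (_ && _)); first by rewrite /swap_of /swap !cE//; lia.
  apply: v12; rewrite !mem_cat; apply/orP; right; apply/orP; left.
  by apply/mapP; exists (u : nat) => //; rewrite mem_iota ltnS.
congr nat_of_bool; apply: v12; rewrite !mem_cat; apply/orP; right; apply/orP; right.
by apply/mapP; exists (u : nat) => //; rewrite mem_iota /=.
Qed.

Hypotheses (f01 : 0 <= f <= 1) (q01 : 0 <= q <= 1) (la01 : 0 <= la <= 1) (y1 : 1 < y).

Let z := q * y^-1 + (1 - q).

Definition chernoff_rate : R := (f * z + (1 - f)) * (la * y + (1 - la)).

(** The product of the weights is y to the power requests minus successes, where a success counts
    only in a slot with a swap. *)
Let weight (v : coord -> bool) (x : coord) (b : bool) : R :=
  match x with
  | (true, false, u) => if swap_of v u && b then y^-1 else 1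
  | (true, true, _) => if b then y else 1
  | _ => 1
  end.

Let y0 : 0 < y. Proof. exact: lt_trans ltr01 y1. Qed.

Let z01 : 0 <= z <= 1.
Proof.
have /andP[q0 q1] := q01.
have yi0 : 0 <= y^-1 by rewrite invr_ge0 ltW.
have yi1 : y^-1 <= 1 by rewrite invf_le1// ltW.
rewrite /z addr_ge0 ?mulr_ge0 ?subr_ge0//=.
by rewrite addrCA gerDl subr_le0 ler_piMr.
Qed.

(** Chernoff's inequality: as [y > 1], y to the excess of requests over successes is at least 1 when
    that excess is positive. *)
Let backlogged_le t v :
  (backlogged t v)%:R <= \prod_(x <- other_coords t) weight v x (v x).
Proof.
rewrite big_cat !big_map !prod_if_expr exprVn /backlogged /=.
have yn n : 0 < y ^+ n by exact: exprn_gt0.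
case: ltnP => /= h; last by apply: mulr_ge0; rewrite ?invr_ge0; exact/ltW/yn.
by rewrite mulrC ler_pdivlMr// mul1r; apply: ler_weXn2l; [exact: ltW|exact: ltnW].
Qed.

Let coord_mean01 x : 0 <= coord_mean x <= 1.
Proof. by case: x => [[[] []] u]. Qed.

Let Ex_backlogged_others t v :
  Ex coord_mean (other_coords t) (fun v => (backlogged t v)%:R) v <=
  z ^+ swap_count (fun u => v (false, false, u)) (fun u => v (false, true, u)) t
    * (la * y + (1 - la)) ^+ t.
Proof.
apply: le_trans (le_Ex _ _ coord_mean01 (backlogged_le t)) _.
rewrite Ex_prod ?uniq_other_coords//; last first.
  (* The weights depend on w only through the swaps, which read label coordinates, and x is not
     one. *)
  move=> w x b /other_coordsP x1; apply/funext => -[[k1 k2] u]; apply/funext => c.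
  suff swE u' : swap_of [eta w with x |-> b] u' = swap_of w u'.
    by case: k1; case: k2 => //=; rewrite swE.
  by case: x x1 => [[x1 x2] x3] /= ->.
rewrite big_cat !big_map le_eqVlt; apply/orP; left; apply/eqP; congr (_ * _).
  rewrite -sum_swap -(prod_if_expr z); apply: eq_bigr => u _.
  rewrite /= andbT andbF -/(swap_of v u) mulr1; case: ifP => // _.
  by rewrite mulr1; ring.
rewrite (eq_bigr (fun=> la * y + (1 - la))) => [|u _]; last by rewrite /= mulr1.
by rewrite big_const_seq count_predT size_iota iter_mulr_1.
Qed.

Lemma Ex_backlogged_le t v :
  Ex coord_mean (label_coords t ++ other_coords t) (fun v => (backlogged t v)%:R) v <=
  2 * chernoff_rate ^+ t.
Proof.
have /andP[z0 z1] := z01; set m := la * y + (1 - la).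
have m0 : 0 <= m.
  by have /andP[la0 la1] := la01; rewrite addr_ge0 ?subr_ge0// mulr_ge0// ltW.
rewrite Ex_cat.
pose lab k (v : coord -> bool) := z ^+ (\sum_(u < t) v (false, k, u : nat))%N.
apply: (@le_trans _ _ (Ex coord_mean (label_coords t)
    (fun v => m ^+ t * (lab false v + lab true v)) v)).
  apply: le_Ex => // w; apply: le_trans (Ex_backlogged_others t w) _.
  rewrite mulrC ler_wpM2l ?exprn_ge0// /swap_count /lab.
  (* The minimum is one of the two exponents, and the other power is nonnegative. *)
  by case: leqP => _; rewrite ?lerDl ?lerDr exprn_ge0.
have ExE k : Ex coord_mean (label_coords t) (lab k) v = (f * z + (1 - f)) ^+ t.
  (* Labels of the other node get weight 1 and integrate out. *)
  pose h (w : coord -> bool) (x : coord) (b : bool) : R :=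
    if (x.1.2 == k) && b then z else 1.
  have -> : lab k = (fun w => \prod_(x <- label_coords t) h w x (w x)).
    apply/funext => w; rewrite big_cat !big_map /h /lab /=.
    by case: (k); rewrite /= prod_if_expr big1_eq ?mulr1 ?mul1r.
  rewrite Ex_prod ?uniq_label_coords// big_cat !big_map /h /=.
  rewrite !big_const_seq !count_predT !size_iota !iter_mulr_1.
  by case: (k) => /=; rewrite !mulr1 subrKC expr1n ?mulr1 ?mul1r.
rewrite ExZ ExD !ExE /chernoff_rate exprMn -/m.
by rewrite le_eqVlt; apply/orP; left; apply/eqP; ring.
Qed.

End Chernoff.

Lemma chernoff_rate_itv (R : realType) (f q la eps : R) :
  0 <= f <= 1 -> 0 <= q <= 1 -> 0 <= la <= 1 -> 0 < eps -> la + eps <= q * f ->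
  0 <= chernoff_rate f q la (1 + eps / 2) < 1.
Proof.
move=> /andP[f0 f1] /andP[q0 q1] /andP[la0 la1] e0 lef; rewrite /chernoff_rate.
set y := 1 + eps / 2.
have y1 : 1 < y by rewrite /y; lra.
have yn0 : y != 0 by rewrite gt_eqF//; lra.
have yi0 : 0 < y^-1 by rewrite invr_gt0; lra.
apply/andP; split.
  apply: mulr_ge0; last by rewrite addr_ge0 ?subr_ge0// mulr_ge0//; lra.
  by rewrite addr_ge0 ?subr_ge0// mulr_ge0// addr_ge0 ?subr_ge0// mulr_ge0// ltW.
rewrite -subr_gt0.
(* The last factor is positive: [q * f] exceeds [la] by at least [eps], while [la * y] exceeds it by
   at most [y - 1], which is [eps / 2]. *)
have -> : 1 - (f * (q / y + (1 - q)) + (1 - f)) * (la * y + (1 - la)) =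
   y^-1 * (y - 1) * (q * f * (1 + la * (y - 1)) - la * y).
  by clearbody y; field.
apply: mulr_gt0; first by apply: mulr_gt0 => //; lra.
have y1E : y - 1 = eps / 2 by rewrite /y addrC addKr.
have h1 : 0 <= q * f * (la * (y - 1)) by rewrite !mulr_ge0//; lra.
have h2 : la * (y - 1) <= y - 1 by rewrite ler_piMl//; lra.
by clearbody y; lra.
Qed.

(** * Borel-Cantelli with geometric bounds *)

Section GeometricBorelCantelli.
Variables (d : measure_display) (T : measurableType d) (R : realType).
Variables (P : probability T R) (B : nat -> set T) (k r : R).

Lemma ae_eventually_notin : (forall t, measurable (B t)) -> 0 <= r < 1 ->
  (forall t, P (B t) <= (k * r ^+ t)%:E)%E ->
  {ae P, forall w, exists N, forall t, (N <= t)%N -> ~ B t w}.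
Proof.
move=> mB /andP[r0 r1] PB.
have sum_lt : (\sum_(n <oo) P (B n) < +oo)%E.
  apply: (@le_lt_trans _ _ (\sum_(n <oo) (k * r ^+ n)%:E)%E).
    by apply: lee_nneseries.
  have cv : (\sum_(0 <= n < m) (k * r ^+ n)%:E)%E @[m --> \oo] --> (k * (1 - r)^-1)%:E.
    under eq_fun do rewrite sumEFin.
    apply: cvg_EFin; first exact: nearW.
    by apply: cvg_geometric_series; rewrite ger0_norm.
  by rewrite (cvg_lim _ cv)// ltry.
(* The null set consists of the outcomes in infinitely many [B t]. *)
exists (lim_sup_set B); split.
- by apply: bigcap_measurable => // n _; exact: bigcup_measurable.
- exact: lim_sup_set_cvg0.
- move=> w /= nw n _; apply: contrapT => nB; apply: nw; exists n => t nt Bt.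
  by apply: nB; exists t.
Qed.

End GeometricBorelCantelli.

(** * From the primitive random variables to the coordinates of a pair *)

Section PairCoordinates.
Variables (d : measure_display) (T : measurableType d) (R : realType)
  (P : probability T R) (K : nat)
  (C : 'I_K -> nat -> T -> bool) (L : 'I_K -> nat -> T -> option 'I_K)
  (S : 'I_K -> 'I_K -> nat -> nat -> T -> bool) (A : 'I_K -> 'I_K -> nat -> T -> bool).
Hypothesis mobs : forall x v, measurable [set w | obs C L S A x w = v].
Hypothesis indep : mutually_independent P (@src_valid K) (obs C L S A).
Variables (i j : 'I_K) (pri prj f q la : R).
Hypothesis ij : (i < j)%N.
Hypotheses (PCi : forall t, P [set w | C i t w] = pri%:E)
  (PCj : forall t, P [set w | C j t w] = prj%:E)
  (PLi : forall t, P [set w | L i t w = Some j] = (f / pri)%:E)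
  (PLj : forall t, P [set w | L j t w = Some i] = (f / prj)%:E)
  (PS : forall t, P [set w | S i j t 0 w] = q%:E)
  (PA : forall t, P [set w | A i j t w] = la%:E)
  (pri0 : pri != 0) (prj0 : prj != 0).

Definition coord_val (x : coord) (w : T) : bool :=
  match x with
  | (false, false, t) => C i t w && (L i t w == Some j)
  | (false, true, t) => C j t w && (L j t w == Some i)
  | (true, false, t) => S i j t 0 w
  | (true, true, t) => A i j t w
  end.

(** A coordinate is true exactly when all its sources take their [target] values. [coord_of]
    recovers it from any source, so distinct coordinates have disjoint sources and inherit
    independence. *)
Let sources (x : coord) : seq (src K) :=
  match x with
  | (false, false, t) => [:: inl (inl (i, t)); inl (inr (i, t))]
  | (false, true, t) => [:: inl (inl (j, t)); inl (inr (j, t))]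
  | (true, false, t) => [:: inr (inl (i, j, t, 0%N))]
  | (true, true, t) => [:: inr (inr (i, j, t))]
  end.

Let coord_of (y : src K) : coord :=
  match y with
  | inl (inl (k, t)) | inl (inr (k, t)) => (false, k == j, t)
  | inr (inl (_, _, t, _)) => (true, false, t)
  | inr (inr (_, _, t)) => (true, true, t)
  end.

(** [obs] encodes the label [Some m] as [m.+1]; the wanted label is j at node i and i at node j. *)
Let target (y : src K) : nat :=
  match y with
  | inl (inr (k, _)) => if k == i then (nat_of_ord j).+1 else (nat_of_ord i).+1
  | _ => 1%N
  end.

Let nij : (i == j) = false.
Proof. by apply/negbTE/eqP => e; move: ij; rewrite e ltnn. Qed.

Let sourcesK x y : y \in sources x -> coord_of y = x.
Proof.
by case: x => [[[] []] t] /=; rewrite !inE; [| |move/orP=> []|move/orP=> []];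
  move=> /eqP ->; rewrite /= ?eqxx ?nij.
Qed.

Let uniq_sources x : uniq (sources x).
Proof. by case: x => [[[] []] t]. Qed.

Let uniq_flatten_sources s : uniq s -> uniq (flatten [seq sources x | x <- s]).
Proof.
elim: s => //= x s IH /andP[xs us]; rewrite cat_uniq uniq_sources IH// andbT /=.
apply/hasPn => y /flatten_mapP[x' x's yx']; apply/negP => yx.
by move: xs; rewrite -(sourcesK yx) (sourcesK yx') x's.
Qed.

Let obsL k t w (m : 'I_K) :
  obs C L S A (inl (inr (k, t))) w = m.+1 <-> L k t w = Some m.
Proof.
rewrite /=; case: (L k t w) => [n|]; split=> //.
- by move=> [] /ord_inj ->.
- by move=> [->].
Qed.

Let obsb (b : bool) : (b : nat) = 1%N <-> b.
Proof. by case: b. Qed.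

Let coord_valP x w :
  coord_val x w <-> forall y, y \in sources x -> obs C L S A y w = target y.
Proof.
case: x => [[[] []] t] /=.
- split=> [h y|/(_ (inr (inr (i, j, t))) (mem_head _ _)) /obsb//].
  by rewrite inE => /eqP -> /=; rewrite h.
- split=> [h y|/(_ (inr (inl (i, j, t, 0%N))) (mem_head _ _)) /obsb//].
  by rewrite inE => /eqP -> /=; rewrite h.
- split=> [/andP[h1 /eqP h2] y|h].
    by rewrite !inE => /orP[]/eqP-> /=; rewrite ?h1// h2 eq_sym nij.
  apply/andP; split; first exact/obsb/(h (inl (inl (j, t)))%type (mem_head _ _)).
  apply/eqP/obsL; rewrite h ?inE ?eqxx ?orbT//=.
  by rewrite eq_sym nij.
- split=> [/andP[h1 /eqP h2] y|h].
    by rewrite !inE => /orP[]/eqP-> /=; rewrite ?h1// h2 eqxx.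
  apply/andP; split; first exact/obsb/(h (inl (inl (i, t))) (mem_head _ _)).
  by apply/eqP/obsL; rewrite h ?inE ?eqxx ?orbT//= eqxx.
Qed.

Lemma measurable_coord_val x : measurable [set w | coord_val x w].
Proof.
have mC k t : measurable [set w | C k t w].
  rewrite (_ : [set _ | _] = [set w | obs C L S A (inl (inl (k, t))) w = 1%N])//.
  by apply/seteqP; split=> w /= /obsb.
have mL k t m : measurable [set w | L k t w == Some m].
  rewrite (_ : [set _ | _] = [set w | obs C L S A (inl (inr (k, t))) w = m.+1])//.
  by apply/seteqP; split=> w; [move=> /eqP /obsL|move=> /obsL /eqP].
case: x => [[[] []] t] /=.
- rewrite (_ : [set _ | _] = [set w | obs C L S A (inr (inr (i, j, t))) w = 1%N])//.
  by apply/seteqP; split=> w /= /obsb.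
- rewrite (_ : [set _ | _] = [set w | obs C L S A (inr (inl (i, j, t, 0%N))) w = 1%N])//.
  by apply/seteqP; split=> w /= /obsb.
- rewrite (_ : [set _ | _] = [set w | C j t w] `&` [set w | L j t w == Some i]).
    exact: measurableI.
  by apply/seteqP; split=> w /= /andP.
- rewrite (_ : [set _ | _] = [set w | C i t w] `&` [set w | L i t w == Some j]).
    exact: measurableI.
  by apply/seteqP; split=> w /= /andP.
Qed.

Let prod_sources x :
  (\prod_(y <- sources x) P [set w | obs C L S A y w = target y])%E =
  (coord_mean f q la x)%:E.
Proof.
have bE (b : T -> bool) : [set w | (b w : nat) = 1%N] = [set w | b w].
  by apply/seteqP; split=> w /= /obsb.
have LE k t (m : 'I_K) :
    [set w | obs C L S A (inl (inr (k, t))) w = m.+1] = [set w | L k t w = Some m].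
  by apply/seteqP; split=> w /obsL.
case: x => [[[] []] t]; rewrite /sources /coord_mean ?big_cons big_nil /target ?mule1.
- by rewrite bE.
- by rewrite bE.
(* Generation and labelling together have probability [prj * (f / prj) = f], as [prj] is nonzero. *)
- by rewrite bE eq_sym nij LE PCj PLj -EFinM mulrC divfK.
- by rewrite bE eqxx LE PCi PLi -EFinM mulrC divfK.
Qed.

Lemma coord_val_indep s : uniq s ->
  P [set w | forall x, x \in s -> coord_val x w] =
  (\prod_(x <- s) coord_mean f q la x)%:E.
Proof.
move=> us.
have -> : [set w | forall x, x \in s -> coord_val x w] =
    [set w | forall y, y \in flatten [seq sources x | x <- s] ->
                       obs C L S A y w = target y].
  apply/seteqP; split=> w /= h.
    by move=> y /flatten_mapP[x xs]; exact: (coord_valP x w).1 (h x xs) y.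
  move=> x xs; apply/coord_valP => y yx; apply: h.
  by apply/flatten_mapP; exists x.
rewrite indep; [|exact: uniq_flatten_sources|].
  rewrite big_flatten big_map -prodEFin.
  by apply: eq_bigr => x _; exact: prod_sources.
apply/allP => y /flatten_mapP[x _].
by case: x => [[[] []] t] /=; rewrite !inE; [| |move/orP=> []|move/orP=> []];
  move=> /eqP ->.
Qed.

Lemma ae_backlog_cleared (eps : R) : 0 < eps -> la + eps <= q * f ->
  {ae P, forall w, exists N, forall t, (N <= t)%N ->
    backlog_cleared (fun i t => C i t w) (fun i t => L i t w)
      (fun i j t k => S i j t k w) (fun i j t => A i j t w) i j t}.
Proof.
move=> e0 lef.
have itv := bernoulli_mean_itv measurable_coord_val coord_val_indep.
have f01 : 0 <= f <= 1 := itv (false, false, 0%N).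
have q01 : 0 <= q <= 1 := itv (true, false, 0%N).
have la01 : 0 <= la <= 1 := itv (true, true, 0%N).
have := @prob_Ex _ _ _ _ _ P _ measurable_coord_val coord_val_indep.
(* The base valuation [fun=> false] is arbitrary: [backlogged t] reads only the listed
   coordinates. *)
move=> /(_ (backlogged _) _ (fun=> false) (uniq_coords _) (@backlogged_local _)) PE.
have rate := chernoff_rate_itv f01 q01 la01 e0 lef.
have y1 : 1 < 1 + eps / 2 by rewrite ltrDl divr_gt0.
have bound t : (P [set w | backlogged t (coord_val^~ w)] <=
    (2 * chernoff_rate f q la (1 + eps / 2) ^+ t)%:E)%E.
  by rewrite (PE t).2 lee_fin; exact: Ex_backlogged_le.
have := ae_eventually_notin (fun t => (PE t).1) rate bound.
apply: filterS => w [N hN]; exists N => t Nt.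
by rewrite /backlog_cleared leqNgt; apply/negP/(hN t Nt).
Qed.

End PairCoordinates.

(** * Combination over all pairs *)

Theorem theorem3 (d : measure_display) (T : measurableType d) (R : realType)
  (P : probability T R) (K : nat)
  (p : 'I_K -> R) (q : R) (lam : 'I_K -> 'I_K -> R) (eps : R)
  (ft : 'I_K -> 'I_K -> R)
  (C : 'I_K -> nat -> T -> bool) (L : 'I_K -> nat -> T -> option 'I_K)
  (S : 'I_K -> 'I_K -> nat -> nat -> T -> bool) (A : 'I_K -> 'I_K -> nat -> T -> bool) :
  (* the primitive random variables are measurable ... *)
  (forall x v, measurable [set w | obs C L S A x w = v]) ->
  (* ... and mutually independent *)
  mutually_independent P (@src_valid K) (obs C L S A) ->
  (* C_{0i}(t) ~ Bernoulli(p_i) *)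
  (forall i t, P [set w | C i t w] = (p i)%:E) ->
  (* swaps succeed with probability q *)
  (forall (i j : 'I_K) t k, (i < j)%N -> P [set w | S i j t k w] = q%:E) ->
  (* A_{ij}(t) ~ Bernoulli(lambda_ij) *)
  (forall (i j : 'I_K) t, (i < j)%N -> P [set w | A i j t w] = (lam i j)%:E) ->
  (forall i j, lam i j = lam j i) ->
  (* (lambda_ij + eps) in Lambda, eps > 0 *)
  0 < eps ->
  inLambda p q (fun i j => lam i j + eps) ->
  (* the parameters ft of pi_STAT *)
  (forall i j, 0 <= ft i j) -> (forall i j, ft i j = ft j i) ->
  (forall j, \sum_(i < K | i != j) ft i j <= p j) ->
  (forall i j, i != j -> lam i j + eps <= q * ft i j) ->
  (* labels: a switch-i pair is labelled (i,j) with probability ft_ij / p_i *)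
  (forall i j t, i != j -> P [set w | L i t w = Some j] = (ft i j / p i)%:E) ->
  {ae P, forall w,
    (* every request is eventually addressed ... *)
    (forall (i j : 'I_K) t, (i < j)%N -> A i j t w ->
       exists sl, addressed_at (fun i t => C i t w) (fun i t => L i t w)
                    (fun i j t k => S i j t k w) (fun i j t => A i j t w) i j t sl) /\
    (* ... and the long-run average latency equals one slot *)
    ((forall M, exists Tn, (M <= num_requests (fun i j t => A i j t w) Tn)%N) ->
     (fun Tn => (total_latency (fun i t => C i t w) (fun i t => L i t w)
                   (fun i j t k => S i j t k w) (fun i j t => A i j t w) Tn)%:R
                / (num_requests (fun i j t => A i j t w) Tn)%:R : R)
       @ \oo --> (1 : R))}.
Proof.
move=> mobs indep PC PS PA lamC e0 _ ft0 ftC ftp lamft PL.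
(* From [q * ft i j >= lam i j + eps > 0] follows [ft i j > 0], and [p i] is at least
   [ft j i = ft i j]. *)
have p0 (i j : 'I_K) : i != j -> 0 <= lam i j -> p i != 0.
  move=> nij lam0; rewrite gt_eqF//; apply: (@lt_le_trans _ _ (ft j i)); last first.
    apply: le_trans (ftp i); rewrite (bigD1 j) 1?eq_sym//= lerDl.
    exact: sumr_ge0.
  rewrite lt0r ft0 andbT; apply/eqP => ft_0.
  by have := lamft _ _ nij; rewrite ftC ft_0 mulr0; apply/negP; rewrite -ltNge; lra.
have : {ae P, forall w, forall ij : 'I_K * 'I_K, (ij.1 < ij.2)%N ->
    exists N, forall t, (N <= t)%N ->
      backlog_cleared (fun i t => C i t w) (fun i t => L i t w)
      (fun i j t k => S i j t k w) (fun i j t => A i j t w) ij.1 ij.2 t}.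
  (* There are finitely many pairs, so their almost sure events can be intersected. *)
  apply: filter_forall => -[i j] /=.
  have [ij|_] := boolP (i < j)%N; last first.
    exact: filterE.
  have nij : i != j by apply/eqP => e; move: ij; rewrite e ltnn.
  have lam0 : 0 <= lam i j.
    by rewrite -lee_fin -(PA i j 0%N ij) measure_ge0.
  have nji : j != i by rewrite eq_sym.
  have PLj t : P [set w | L j t w = Some i] = (ft i j / p j)%:E by rewrite PL// ftC.
  have lam0' : 0 <= lam j i by rewrite lamC.
  have h := ae_backlog_cleared mobs indep ij (PC i) (PC j) (fun t => PL i j t nij)
    PLj (fun t => PS i j t 0%N ij) (fun t => PA i j t ij)
    (p0 _ _ nij lam0) (p0 _ _ nji lam0') e0 (lamft _ _ nij).
  by apply: filterS h.
apply: filterS => w good.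
(* One threshold per pair, with 0 where [i < j] fails; the maximum serves all pairs. *)
pose N0 (ij : 'I_K * 'I_K) : nat := if pselect (ij.1 < ij.2)%N is left h
  then projT1 (cid (good ij h)) else 0%N.
have goodN (i j : 'I_K) : (i < j)%N -> forall t, (\max_ij N0 ij <= t)%N ->
    backlog_cleared (fun i t => C i t w) (fun i t => L i t w)
      (fun i j t k => S i j t k w) (fun i j t => A i j t w) i j t.
  move=> ij t Nt.
  have : (N0 (i, j) <= t)%N by apply: leq_trans Nt; exact: leq_bigmax.
  rewrite /N0; case: pselect => //= h; case: cid => /= n hn nt; exact: hn.
split=> [i j t ij At|]; first exact: (addressed_eventually ij (goodN i j ij) At).
exact: (average_latency_cvg1 goodN).
Qed.
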